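(* Let $g>0$, $k>0$, $\eta\in\mathbb{R}$ be constants, let $b=b(\mathbf{x})$ be a given time-independent bottom topography, and fix the time step $\Delta t>0$ and the parameter $\Delta x>0$. For $\varepsilon>0$ set $\mu(\varepsilon)=e^{-\varepsilon^2/\Delta x}$ (so $\mu(0)=1$). Consider the first order implicit-explicit scheme, semi-discrete in time and continuous in space, which computes $(h^{n+1},\mathbf{q}^{n+1})$ from $(h^n,\mathbf{q}^n)$ by $$\frac{h^{n+1}-h^n}{\Delta t}+\nabla\cdot\mathbf{q}^n+\mu(\varepsilon)\,\nabla\cdot\left(\sqrt{\frac{h^{\eta+1}}{k^2}}\frac{\nabla H}{\sqrt{|\nabla H|}}\right)^{n}=\mu(\varepsilon)\,\nabla\cdot\left(\sqrt{\frac{h^{\eta+1}}{k^2}}\frac{\nabla H}{\sqrt{|\nabla H|}}\right)^{n+1},$$ $$\frac{\mathbf{q}^{n+1}-\mathbf{q}^n}{\Delta t}+\nabla\cdot\left(\frac{\mathbf{q}\otimes\mathbf{q}}{h}\right)^{n}+\frac{1}{\varepsilon^2}\nabla\left(\frac{g}{2}h^2\right)^{n+1}=-\frac{1}{\varepsilon^2}g\,h^{n+1}\nabla b-\frac{1}{\varepsilon^2}\gamma^{n+1}\mathbf{q}^{n+1},\qquad \gamma^{n+1}=\frac{gk^2|\mathbf{q}^{n+1}|}{(h^{n+1})^{\eta}},$$ where $H^n=h^n+b$ for every $n$. If the initial conditions are well-prepared, then as $\varepsilon\to0$ the scheme is asymptotic preserving: in the limit $\varepsilon\to0$ (with $\Delta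 t$ fixed) it becomes, for the leading order terms $h_0^n$ and for all $n\ge 0$, a consistent time discretization of the limiting equation $$\partial_t h_0=\nabla\cdot\left(\sqrt{\frac{h_0^{\eta+1}}{k^2}}\frac{\nabla H_0}{\sqrt{|\nabla H_0|}}\right),\qquad H_0=h_0+b.$$
   Context: The scheme approximates the scaled shallow water equations with Manning friction $$\partial_t h+\nabla\cdot\mathbf{q}=0,\qquad \partial_t\mathbf{q}+\nabla\cdot\left(\frac{\mathbf{q}\otimes\mathbf{q}}{h}\right)+\frac{1}{\varepsilon^2}\nabla\left(\frac g2h^2\right)=-\frac1{\varepsilon^2}gh\nabla b-\frac1{\varepsilon^2}\gamma\mathbf{q},\qquad \gamma=\frac{gk^2|\mathbf{q}|}{h^\eta},$$ where $h>0$ is the water depth, $\mathbf{q}$ the (vector-valued) momentum, $|\cdot|$ the Euclidean norm, and $H=h+b$ the surface level. A superscript $n$ on an expression means that all time-dependent quantities in it are evaluated at time level $n$. The quantity $\nabla H/\sqrt{|\nabla H|}$ is understood to be $0$ where $\nabla H=0$. Formal setting: space is kept continuous, and all functions are assumed as smooth as needed for the expressions to make sense. The numerical solution, which depends on $\varepsilon$, is assumed to admit at every time level $n\ge0$ a Chapman-Enskog expansion $$h^n(\mathbf{x})=h_0^n(\mathbf{x})+\mathcal{O}(\varepsilon),\qquad \mathbf{q}^n(\mathbf{x})=\mathbf{q}_0^n(\mathbf{x})+\mathcal{O}(\varepsilon)\qquad(\varepsilon\to0),$$ with $h_0^n>0$, the expansions being compatible with the spatial differential operators and nonlinear expressions appearing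 in the scheme (i.e. each such expression converges, as $\varepsilon\to0$, to the same expression evaluated at the leading order terms). Write $H_0^n=h_0^n+b$. Well-prepared initial conditions: the expansion above holds at $n=0$ and $$\mathbf{q}_0^0=-\left(\sqrt{\frac{h_0^{\eta+1}}{k^2}}\frac{\nabla H_0}{\sqrt{|\nabla H_0|}}\right)^{0}.$$ Asymptotic preserving (AP): for given (fixed) discretization parameters, the scheme becomes, as $\varepsilon\to0$, a consistent discretization of the limiting equation; that is, the leading order terms $h_0^n$ satisfy, for all $n\ge0$, a one-step relation between $h_0^n$ and $h_0^{n+1}$ which is a consistent time discretization of the limiting equation (its truncation error on smooth exact solutions of the limiting equation tends to $0$ as $\Delta t\to0$). *)

(* Defs.v *)
From mathcomp Require Import all_boot all_order all_algebra.
From mathcomp Require Import all_classical all_reals all_analysis.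

Set Implicit Arguments.
Unset Strict Implicit.
Unset Printing Implicit Defensive.

Import Order.TTheory GRing.Theory Num.Theory.
Import numFieldNormedType.Exports.

Local Open Scope classical_set_scope.
Local Open Scope ring_scope.

Section VectorCalculus.
Context {R : realType} {d : nat}.
Implicit Types (f : 'rV[R]_d -> R) (v : 'rV[R]_d -> 'rV[R]_d).

(* The library norm on row vectors is the sup norm, hence this definition. *)
Definition enorm (u : 'rV[R]_d) : R := Num.sqrt (\sum_i u ord0 i ^+ 2).

Definition pderiv (i : 'I_d) f (x : 'rV[R]_d) : R :=
  'D_(delta_mx ord0 i) f x.

Definition grad f (x : 'rV[R]_d) : 'rV[R]_d := \row_i pderiv i f x.

Definition div v (x : 'rV[R]_d) : R := \sum_i pderiv i (fun y => v y ord0 i) x.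

Definition div_tensor (A : 'rV[R]_d -> 'M[R]_d) (x : 'rV[R]_d) : 'rV[R]_d :=
  \row_j \sum_i pderiv i (fun y => A y i j) x.

Definition tensor (u w : 'rV[R]_d) : 'M[R]_d := u^T *m w.

End VectorCalculus.

Section ShallowWater.
Context {R : realType} {d : nat}.
Variables (Omega : set 'rV[R]_d) (g k eta : R) (b : 'rV[R]_d -> R).
Implicit Types (h : 'rV[R]_d -> R) (q : 'rV[R]_d -> 'rV[R]_d).

(* Where the gradient of H = h + b vanishes the value is 0, since 0^-1 = 0. *)
Definition flux h (x : 'rV[R]_d) : 'rV[R]_d :=
  let dH := grad (h \+ b) x in
  (Num.sqrt (h x `^ (eta + 1) / k ^+ 2) / Num.sqrt (enorm dH)) *: dH.

Definition convection h q : 'rV[R]_d -> 'rV[R]_d :=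
  div_tensor (fun y => (h y)^-1 *: tensor (q y) (q y)).

Definition pressure_grad h : 'rV[R]_d -> 'rV[R]_d :=
  grad (fun y => g / 2 * h y ^+ 2).

Definition gamma h q (x : 'rV[R]_d) : R :=
  g * k ^+ 2 * enorm (q x) / (h x `^ eta).

(* Positive depth, and enough smoothness for the divergences and gradients of
   the scheme to be genuine ones rather than default values of ['D_]. *)
Record regular_state h q : Prop := RegularState {
  depth_gt0 : forall x, Omega x -> 0 < h x;
  depth_diff : forall x, Omega x -> differentiable h x;
  momentum_diff : forall x, Omega x -> differentiable q x;
  flux_diff : forall x, Omega x -> differentiable (flux h) x
}.

Definition mu (dx eps : R) : R := expR (- (eps ^+ 2 / dx)).

Definition mass_step (dt dx eps : R) h q h' : Prop :=
  forall x, Omega x ->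
    (h' x - h x) / dt + div q x + mu dx eps * div (flux h) x
    = mu dx eps * div (flux h') x.

Definition momentum_step (dt eps : R) h q h' q' : Prop :=
  forall x, Omega x ->
    dt^-1 *: (q' x - q x) + convection h q x
      + (eps ^+ 2)^-1 *: pressure_grad h' x
    = - (((eps ^+ 2)^-1 * (g * h' x)) *: grad b x)
      - ((eps ^+ 2)^-1 * gamma h' q' x) *: q' x.

Definition imex_scheme (dt dx eps : R)
    (h : nat -> 'rV[R]_d -> R) (q : nat -> 'rV[R]_d -> 'rV[R]_d) : Prop :=
  (forall n, regular_state (h n) (q n)) /\
  (forall n, mass_step dt dx eps (h n) (q n) (h n.+1)) /\
  (forall n, momentum_step dt eps (h n) (q n) (h n.+1) (q n.+1)).

(* [h e], [q e] are the fields at one time level, as functions of epsilon = e.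
   All limits are pointwise in space, which is all that is needed. The fields
   [ce_div] to [ce_friction] are the compatibility of the expansion with the
   differential and nonlinear expressions of the scheme; the remaining term
   [g * h *: grad b] is linear in [h]. *)
Record chapman_enskog (h : R -> 'rV[R]_d -> R)
    (q : R -> 'rV[R]_d -> 'rV[R]_d) h0 q0 : Prop := ChapmanEnskog {
  ce_regular : regular_state h0 q0;
  ce_depth : forall x, Omega x ->
    (fun e => h e x - h0 x) =O_ (0^'+) id;
  ce_momentum : forall x, Omega x ->
    (fun e => q e x - q0 x) =O_ (0^'+) id;
  ce_div : forall x, Omega x ->
    div (q e) x @[e --> 0^'+] --> div q0 x;
  ce_div_flux : forall x, Omega x ->
    div (flux (h e)) x @[e --> 0^'+] --> div (flux h0) x;
  ce_convection : forall x, Omega x ->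
    convection (h e) (q e) x @[e --> 0^'+] --> convection h0 q0 x;
  ce_pressure : forall x, Omega x ->
    pressure_grad (h e) x @[e --> 0^'+] --> pressure_grad h0 x;
  ce_friction : forall x, Omega x ->
    gamma (h e) (q e) x *: q e x @[e --> 0^'+] --> gamma h0 q0 x *: q0 x
}.

Definition well_prepared h0 q0 : Prop :=
  forall x, Omega x -> q0 x = - flux h0 x.

(* Right-hand side of the limiting equation. *)
Definition limit_op h : 'rV[R]_d -> R := div (flux h).

(* The last field holds, for a solution of the limiting equation, exactly when
   the solution is continuously differentiable in time. *)
Record smooth_evolution (T : R) (u : R -> 'rV[R]_d -> R) : Prop :=
  SmoothEvolution {
  se_gt0 : forall t x, 0 < t < T -> Omega x -> 0 < u t x;
  se_diff : forall t x, 0 < t < T -> Omega x -> differentiable (u t) x;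
  se_flux_diff : forall t x, 0 < t < T -> Omega x ->
    differentiable (flux (u t)) x;
  se_derivable : forall t x, 0 < t < T -> Omega x -> derivable (u ^~ x) t 1;
  se_op_continuous : forall t x, 0 < t < T -> Omega x ->
    {for t, continuous (fun r => limit_op (u r) x)}
}.

Definition exact_solution (T : R) (u : R -> 'rV[R]_d -> R) : Prop :=
  smooth_evolution T u /\
  forall t x, 0 < t < T -> Omega x -> derive1 (u ^~ x) t = limit_op (u t) x.

(* A one-step time discretization is given by an operator [Psi] acting on two
   consecutive states. The time step enters only through the difference
   quotient: otherwise a relation at one fixed time step would not be
   constrained at all by consistency, a property of small time steps. *)
Definition one_step_residual
    (Psi : ('rV[R]_d -> R) -> ('rV[R]_d -> R) -> 'rV[R]_d -> R)
    (dt : R) h h' (x : 'rV[R]_d) : R :=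
  (h' x - h x) / dt - Psi h h' x.

(* Consistency is required along all smooth evolutions and not only along exact
   solutions, so that it does not depend on how many of those exist. Along an
   exact solution the limit is 0, see [consistent_truncation]. *)
Definition consistent_discretization
    (Psi : ('rV[R]_d -> R) -> ('rV[R]_d -> R) -> 'rV[R]_d -> R) : Prop :=
  forall T u, smooth_evolution T u -> forall t x, 0 < t < T -> Omega x ->
    one_step_residual Psi dt (u t) (u (t + dt)) x @[dt --> 0^'+]
      --> derive1 (u ^~ x) t - limit_op (u t) x.

Lemma consistent_truncation Psi : consistent_discretization Psi ->
  forall T u, exact_solution T u -> forall t x, 0 < t < T -> Omega x ->
    one_step_residual Psi dt (u t) (u (t + dt)) x @[dt --> 0^'+] --> (0 : R).
Proof.
move=> cPsi T u [su eu] t x tT Ox.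
by have := cPsi T u su t x tT Ox; rewrite eu // subrr.
Qed.

(* The discretization parameters [dt], [dx] are fixed while epsilon tends to 0,
   but the limiting discretization [Psi] is the same for all of them and for
   all solutions. *)
Definition asymptotic_preserving
    (scheme : R -> R -> R -> (nat -> 'rV[R]_d -> R) ->
              (nat -> 'rV[R]_d -> 'rV[R]_d) -> Prop) : Prop :=
  exists Psi, consistent_discretization Psi /\
    forall dt dx : R, 0 < dt -> 0 < dx ->
    forall (h : R -> nat -> 'rV[R]_d -> R)
           (q : R -> nat -> 'rV[R]_d -> 'rV[R]_d)
           (h0 : nat -> 'rV[R]_d -> R) (q0 : nat -> 'rV[R]_d -> 'rV[R]_d),
      (forall eps, 0 < eps -> scheme dt dx eps (h eps) (q eps)) ->
      (forall n, chapman_enskog (fun e => h e n) (fun e => q e n)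
                                (h0 n) (q0 n)) ->
      well_prepared (h0 0%N) (q0 0%N) ->
      forall n x, Omega x -> one_step_residual Psi dt (h0 n) (h0 n.+1) x = 0.

End ShallowWater.

(* Main.v *)
(* Multiplying the momentum step by eps^2 and letting eps tend to 0 leaves only
   the stiff terms, i.e. the balance g h grad H = - gamma q between surface slope
   and friction at the new time level. Solved for q, it says q = - flux h, which
   is the well-prepared condition again; so q0^n = - flux h0^n for all n. As
   Omega is open, div q0^n then cancels the explicit flux in the limit of the
   mass step, and what remains is the implicit Euler discretization of the
   limiting equation. *)

Require Import Defs.
From mathcomp Require Import all_boot all_order all_algebra.
From mathcomp Require Import all_classical all_reals all_analysis.
From mathcomp Require Import ring.

Set Implicit Arguments.
Unset Strict Implicit.
Unset Printing Implicit Defensive.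

Import Order.TTheory GRing.Theory Num.Theory.
Import numFieldNormedType.Exports.
Local Open Scope classical_set_scope.
Local Open Scope ring_scope.

Lemma cvg_sqr_at_right0 {R : realType} :
  e ^+ 2 @[e --> (0 : R)^'+] --> (0 : R).
Proof.
apply: cvg_at_right_filter; rewrite -[X in _ --> X](@expr0n R 2).
exact: exprn_continuous.
Qed.

(** Turns the O(epsilon) fields of the expansion into plain limits: the error bound [C * e] is at
    most [r] once [e <= r / C]. *)
Lemma cvg_bigO_id {R : realType} {V : normedModType R} (f : R -> V) (l : V) :
  (fun e => f e - l) =O_ (0^'+) id -> f e @[e --> 0^'+] --> l.
Proof.
move=> /eqO_exP [C C0 fC]; apply/subr_cvg0/cvgr0Pnorm_le => r r0.
near=> e; apply: (@le_trans _ _ (C * `|e|)); first by near: e; exact: fC.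
rewrite gtr0_norm// mulrC -ler_pdivlMr//; near: e.
by apply: nbhs_right_le; rewrite divr_gt0.
Unshelve. all: by end_near. Qed.

Section VectorCalculus.
Context {R : realType} {d : nat}.
Implicit Types (u : 'rV[R]_d) (f : 'rV[R]_d -> R) (v w : 'rV[R]_d -> 'rV[R]_d).

Lemma enormZ (c : R) u : enorm (c *: u) = `|c| * enorm u.
Proof.
rewrite /enorm -sqrtr_sqr -sqrtrM ?sqr_ge0// mulr_sumr.
by congr Num.sqrt; apply: eq_bigr => i _; rewrite mxE exprMn.
Qed.

Lemma enorm_ge0 u : 0 <= enorm u. Proof. exact: sqrtr_ge0. Qed.

Lemma enorm_eq0 u : enorm u = 0 -> u = 0.
Proof.
have sq_ge0 i : 0 <= u ord0 i ^+ 2 by exact: sqr_ge0.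
move=> /eqP; rewrite sqrtr_eq0 => u0; apply/rowP => i; rewrite mxE.
apply/eqP; rewrite -sqrf_eq0 eq_le sq_ge0 andbT (le_trans _ u0)//.
by rewrite (bigD1 i)//= lerDl sumr_ge0.
Qed.

Lemma gradD f1 f2 x : differentiable f1 x -> differentiable f2 x ->
  grad (f1 \+ f2) x = grad f1 x + grad f2 x.
Proof.
move=> df1 df2; apply/rowP => i; rewrite !mxE /pderiv.
by rewrite deriveD//; exact: diff_derivable.
Qed.

Lemma pressure_gradE g f x : differentiable f x ->
  pressure_grad g f x = (g * f x) *: grad f x.
Proof.
move=> df; apply/rowP => i; rewrite !mxE /pderiv.
have dv : derivable f x (delta_mx ord0 i) by exact: diff_derivable.
rewrite (_ : (fun y => _) = (g / 2) \*: (f ^+ 2)); last first.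
  by apply/funext => y; rewrite /= /GRing.scale/= fctE.
rewrite deriveZ ?deriveX//; last exact: derivableX.
by rewrite /GRing.scale /= expr1; field.
Qed.

(** A derivative at [x] sees only the values near [x], and openness makes the two fields opposite on
    a whole neighbourhood of [x]. *)
Lemma div_opp_on (Omega : set 'rV[R]_d) v w x : open Omega -> Omega x ->
  (forall y, Omega y -> v y = - w y) -> differentiable w x ->
  div v x = - div w x.
Proof.
move=> oO Ox vw dw; rewrite /div -sumrN; apply: eq_bigr => i _.
rewrite /pderiv -deriveN; last first.
  apply: diff_derivable.
  apply: (@differentiable_comp _ _ _ _ w (fun u : 'rV[R]_d => u ord0 i)) => //.
  exact: differentiable_coord.
apply: near_eq_derive; near=> y; rewrite vw ?mxE//.
by near: y; exact: open_nbhs_nbhs.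
Unshelve. all: by end_near. Qed.

(* Taking norms in the hypothesis gives [|q| = sqrt (a / k^2) sqrt |G|], after
   which the equation is linear in [q]. *)
Lemma friction_balance (a k : R) (q G : 'rV[R]_d) : 0 < a -> 0 < k ->
  a *: G = - ((k ^+ 2 * enorm q) *: q) ->
  q = - ((Num.sqrt (a / k ^+ 2) / Num.sqrt (enorm G)) *: G).
Proof.
move=> a0 k0 E.
have k20 : 0 < k ^+ 2 by rewrite exprn_gt0.
set s := Num.sqrt (a / k ^+ 2); set r := Num.sqrt (enorm G).
have s0 : 0 < s by rewrite sqrtr_gt0 divr_gt0.
have s2 : a = k ^+ 2 * s ^+ 2.
  by rewrite sqr_sqrtr ?divr_ge0 ?ltW// mulrCA divff ?mulr1// gt_eqF.
have r2 : enorm G = r ^+ 2 by rewrite sqr_sqrtr// enorm_ge0.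
have nE : enorm q = s * r.
  apply/eqP; rewrite -(@eqrXn2 _ 2)// ?enorm_ge0 ?mulr_ge0 ?sqrtr_ge0//.
  apply/eqP; apply: (mulfI (lt0r_neq0 k20)).
  have := congr1 enorm E; rewrite -scaleNr !enormZ normrN gtr0_norm//.
  rewrite ger0_norm; last by rewrite mulr_ge0 ?enorm_ge0// ltW.
  by rewrite r2 {1}s2 => nE; rewrite exprMn [RHS]mulrA nE expr2 mulrA.
(* If [G = 0], then [nE] forces [q = 0], and the right-hand side is 0 as well because [0^-1 = 0]. *)
have [r0|r0] := eqVneq r 0.
  by rewrite (@enorm_eq0 q) ?nE r0 ?mulr0// invr0 mulr0 scale0r oppr0.
(* By [nE] this scalar is [k ^+ 2 * enorm q], the coefficient of [q] in [E], so multiplying the goal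
   by it makes [E] applicable. *)
have c0 : k ^+ 2 * (s * r) != 0 by rewrite !mulf_neq0// gt_eqF.
apply: (scalerI c0); rewrite -{1}nE -[LHS]opprK -E s2 scalerN scalerA.
congr (- (_ *: _)); field; exact: r0.
Qed.

End VectorCalculus.

Section ShallowWater.
Context {R : realType} {d : nat}.
Variables (Omega : set 'rV[R]_d) (g k eta : R) (b : 'rV[R]_d -> R).
Hypotheses (g_gt0 : 0 < g) (k_gt0 : 0 < k)
  (b_diff : forall x, Omega x -> differentiable b x).

(** The pressure gradient is [g h grad h], so with the bottom term it forms [g h grad (h + b)], and
    [friction_balance] solves for [q]. *)
Lemma stiff_balance h q x : regular_state Omega k eta b h q -> Omega x ->
  pressure_grad g h x + (g * h x) *: grad b x + gamma g k eta h q x *: q x = 0 ->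
  q x = - flux k eta b h x.
Proof.
move=> rs Ox.
have hx : 0 < h x by exact: (depth_gt0 rs).
have dh : differentiable h x by exact: (depth_diff rs).
rewrite pressure_gradE// -scalerDr -gradD//; last exact: b_diff.
move=> /eqP; rewrite addr_eq0 => /eqP E.
apply: friction_balance => //; first exact: powR_gt0.
have he : 0 < h x `^ eta by exact: powR_gt0.
have -> : h x `^ (eta + 1) = h x `^ eta / g * (g * h x).
  rewrite powRD; last by apply/implyP => _; rewrite gt_eqF.
  by rewrite powRr1 ?ltW//; field; rewrite gt_eqF.
rewrite -scalerA E scalerN scalerA /gamma; congr (- (_ *: _)).
by field; rewrite !gt_eqF.
Qed.

Lemma momentum_step_limit dt h q h' q' h0 q0 h0' q0' x :
  (forall e, 0 < e ->
    momentum_step Omega g k eta b dt e (h e) (q e) (h' e) (q' e)) ->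
  chapman_enskog Omega g k eta b h q h0 q0 ->
  chapman_enskog Omega g k eta b h' q' h0' q0' ->
  Omega x ->
  pressure_grad g h0' x + (g * h0' x) *: grad b x
    + gamma g k eta h0' q0' x *: q0' x = 0.
Proof.
move=> step ce ce' Ox.
(* [P] collects the stiff terms and [S] the others; the step says [S e = - P e / e ^+ 2]. As [S]
   converges, [- e ^+ 2 *: S e] tends to 0. *)
pose P e := pressure_grad g (h' e) x + (g * h' e x) *: grad b x
  + gamma g k eta (h' e) (q' e) x *: q' e x.
pose S e := dt^-1 *: (q' e x - q e x) + convection (h e) (q e) x.
have cP : P e @[e --> 0^'+] --> pressure_grad g h0' x
    + (g * h0' x) *: grad b x + gamma g k eta h0' q0' x *: q0' x.
  apply: cvgD; last exact: (ce_friction ce').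
  apply: cvgD; first exact: (ce_pressure ce').
  apply: cvgZr_tmp; apply: cvgMl_tmp.
  by apply: cvg_bigO_id; exact: (ce_depth ce').
have cS : S e @[e --> 0^'+] --> dt^-1 *: (q0' x - q0 x) + convection h0 q0 x.
  apply: cvgD; last exact: (ce_convection ce).
  apply: cvgZl_tmp; apply: cvgB; apply: cvg_bigO_id.
    exact: (ce_momentum ce').
  exact: (ce_momentum ce).
have ce2 : - e ^+ 2 @[e --> (0 : R)^'+] --> (0 : R).
  rewrite -[X in _ --> X]oppr0.
  apply: cvgN; exact: cvg_sqr_at_right0.
have cS0 : - e ^+ 2 *: S e @[e --> 0^'+] --> (0 : 'rV[R]_d).
  by rewrite -(scale0r (dt^-1 *: (q0' x - q0 x) + convection h0 q0 x));
    apply: cvgZ.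
(* [P e] equals [- e ^+ 2 *: S e] for [e > 0], so 0 is also its limit. *)
apply: (cvg_unique (@norm_hausdorff R 'rV[R]_d) cP).
apply: (@cvg_trans _ ((- e ^+ 2 *: S e) @[e --> 0^'+]) _ _ _ cS0).
apply: near_eq_cvg; near=> e.
have e0 : 0 < e by near: e; exact: nbhs_right_gt.
have e2 : e ^+ 2 != 0 by rewrite expf_neq0// gt_eqF.
suff -> : S e = - ((e ^+ 2)^-1 *: P e).
  by rewrite scalerN scaleNr opprK scalerA divff// scale1r.
apply: (addIr ((e ^+ 2)^-1 *: pressure_grad g (h' e) x)).
rewrite step// /P !scalerDr !scalerA; apply/esym.
by rewrite -addrA opprD addrAC addNr add0r opprD.
Unshelve. all: by end_near. Qed.

(** Nothing here is stiff: [mu dx e] tends to [expR 0 = 1], both sides of the step converge, and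
    their limits agree by uniqueness. *)
Lemma mass_step_limit dt dx h q h' q' h0 q0 h0' q0' x :
  (forall e, 0 < e -> mass_step Omega k eta b dt dx e (h e) (q e) (h' e)) ->
  chapman_enskog Omega g k eta b h q h0 q0 ->
  chapman_enskog Omega g k eta b h' q' h0' q0' ->
  Omega x ->
  (h0' x - h0 x) / dt + div q0 x + div (flux k eta b h0) x
    = div (flux k eta b h0') x.
Proof.
move=> step ce ce' Ox.
have cmu : mu dx e @[e --> (0 : R)^'+] --> (1 : R).
  have c0 : - (e ^+ 2 / dx) @[e --> (0 : R)^'+] --> - (0 / dx).
    by apply: cvgN; apply: cvgMr_tmp; exact: cvg_sqr_at_right0.
  have := cvg_comp _ _ c0 (@continuous_expR R _).
  by rewrite mul0r oppr0 expR0.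
have cl : (h' e x - h e x) / dt + div (q e) x
      + mu dx e * div (flux k eta b (h e)) x @[e --> (0 : R)^'+]
    --> (h0' x - h0 x) / dt + div q0 x + 1 * div (flux k eta b h0) x.
  apply: cvgD; last by apply: cvgM => //; exact: (ce_div_flux ce).
  apply: cvgD; last exact: (ce_div ce).
  by apply: cvgMr_tmp; apply: cvgB; apply: cvg_bigO_id;
    [exact: (ce_depth ce')|exact: (ce_depth ce)].
have cr : mu dx e * div (flux k eta b (h' e)) x @[e --> (0 : R)^'+]
    --> 1 * div (flux k eta b h0') x.
  by apply: cvgM => //; exact: (ce_div_flux ce').
rewrite -[X in _ + X = _]mul1r -[RHS]mul1r; apply: (cvg_unique (@Rhausdorff R) cl).
apply: (@cvg_trans _ (mu dx e * div (flux k eta b (h' e)) x @[e --> (0 : R)^'+])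
  _ _ _ cr).
apply: near_eq_cvg; near=> e; exact/esym/step.
Unshelve. all: by end_near. Qed.

(** Implicit Euler evaluates the operator at time [t + dt], so its convergence to the value at [t]
    is the time continuity in [se_op_continuous]. *)
Lemma implicit_consistent :
  consistent_discretization Omega k eta b (fun _ h' => limit_op k eta b h').
Proof.
move=> T u su t x tT Ox; rewrite /one_step_residual.
apply: cvgB.
(* The time derivative is a two-sided limit; only its restriction to positive steps is kept. *)
- have /cvg_dnbhs_at_right cu : (fun r => r^-1 *: (u (r + t) x - u t x)) @ 0^'
      --> derive1 (u ^~ x) t.
    rewrite /derive1 (_ : (fun r => _) =
        (fun r => r^-1 *: (u (r *: 1 + t) x - u t x))).
      exact: (se_derivable su tT Ox).
    by apply/funext => r; rewrite /GRing.scale /= mulr1.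
  rewrite (_ : (fun dt => _) = (fun r => r^-1 *: (u (r + t) x - u t x)))//.
  by apply/funext => r; rewrite [RHS]mulrC (addrC r).
- have ct : t + dt @[dt --> 0^'+] --> t.
    rewrite -[X in _ --> X]addr0; apply: cvgD; first exact: cvg_cst.
    by apply: cvg_at_right_filter; exact: cvg_id.
  exact: (cvg_comp _ _ ct (se_op_continuous su tT Ox)).
Qed.

End ShallowWater.

Theorem theorem3p1 (R : realType) (d : nat) (Omega : set 'rV[R]_d)
    (g k eta : R) (b : 'rV[R]_d -> R) :
  open Omega -> 0 < g -> 0 < k ->
  (forall x, Omega x -> differentiable b x) ->
  asymptotic_preserving Omega g k eta b (imex_scheme Omega g k eta b).
Proof.
move=> oO g0 k0 db; exists (fun _ h' => limit_op k eta b h').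
split; first exact: implicit_consistent.
move=> dt dx dt0 dx0 h q h0 q0 sch ce wp n x Ox.
(* A case split suffices instead of an induction: at level [n.+1] the stiff limit yields the balance
   whatever [q0 n] is. *)
have bal y : Omega y -> q0 n y = - flux k eta b (h0 n) y.
  case: n => [|n] Oy; first exact: wp.
  apply: (stiff_balance g0 k0 db (ce_regular (ce n.+1)) Oy).
  apply: (momentum_step_limit _ (ce n) (ce n.+1) Oy) => e e0.
  by case: (sch e e0) => _ [_]; apply.
have mass e : 0 < e ->
    mass_step Omega k eta b dt dx e (h e n) (q e n) (h e n.+1).
  by move=> e0; case: (sch e e0) => _ [+ _]; apply.
have := mass_step_limit mass (ce n) (ce n.+1) Ox.
(* [div (q0 n) x] becomes minus the divergence of the explicit flux, and [subrK] cancels the two. *)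
rewrite (div_opp_on oO Ox bal); last exact: (flux_diff (ce_regular (ce n))).
by rewrite subrK /one_step_residual => ->; rewrite subrr.
Qed.
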